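(* Let $T\in\mathfrak{P}_n$ be a contracting transducer with at least one completion in $H(\mathfrak{C}_n)$. Then $\mathcal{H}(T)=\mathcal{F}(T)$.
   Context: $n\ge2$, $X_n=\{0,\dots,n-1\}$, $X_n^*$ is the set of finite words, $\epsilon$ the empty word, $\mathfrak{C}_n=X_n^\omega$ is Cantor space, $H(\mathfrak{C}_n)$ its homeomorphism group, $[\eta]=\eta\mathfrak{C}_n$ the cone of $\eta\in X_n^*$. If $u$ is a prefix of $v$, $v-u$ denotes the word $\mu$ with $v=u\mu$. Functions act on the right. A maximal antichain of $X_n^*$ is a finite set of words whose cones partition $\mathfrak{C}_n$. A transducer $T=\langle X_n,Q_T,\pi_T,\lambda_T\rangle$ consists of a finite state set $Q_T$ and functions $\pi_T:X_n\times Q_T\to Q_T$, $\lambda_T:X_n\times Q_T\to X_n^*$, extended to words by $\pi_T(\epsilon,q)=q$, $\lambda_T(\epsilon,q)=\epsilon$, $\pi_T(xw,q)=\pi_T(w,\pi_T(x,q))$, $\lambda_T(xw,q)=\lambda_T(x,q)\lambda_T(w,\pi_T(x,q))$ (and $\lambda_T$ likewise to infinite words). For a state $q$, $T_q$ is the initial transducer started at $q$, with induced map $\mathfrak{C}_n\to\mathfrak{C}_n$, $\delta\mapsto\lambda_T(\delta,q)$ (outputs on infinite words being infinite), and $\mathrm{im}(q)$ is its image. Two initial transducers are $\omega$-equivalent if they induce the same map on $\mathfrak{C}_n$. $T$ is partially invertible if for every state $q$ the map $T_q$ is injective and has clopen image; $\mathfrak{P}_n$ is the set of partially invertible transducers over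 $X_n$. The product $TR$ has state set $Q_T\times Q_R$, with $\lambda_{TR}(i,(t,r))=\lambda_R(\lambda_T(i,t),r)$ and $\pi_{TR}(i,(t,r))=(\pi_T(i,t),\pi_R(\lambda_T(i,t),r))$. Completions. For $T\in\mathfrak{P}_n$, a viable combination is a pair of tuples $((\rho_1,\dots,\rho_l),(p_1,\dots,p_l))$ of (not necessarily distinct or incomparable) words $\rho_i\in X_n^*$ and (not necessarily distinct) states $p_i$ such that $\bigcup_i\rho_i\,\mathrm{im}(p_i)=\mathfrak{C}_n$ and $\rho_i\,\mathrm{im}(p_i)\cap\rho_j\,\mathrm{im}(p_j)=\emptyset$ for $i\ne j$. If $l\equiv1\pmod{n-1}$, then for any maximal antichain $\{\eta_1,\dots,\eta_l\}$ of $X_n^*$ the homeomorphism $h$ of $\mathfrak{C}_n$ with $(\eta_i\chi)h=\rho_i(\chi)T_{p_i}$ (all $i$, $\chi\in\mathfrak{C}_n$) is called a completion of $T$ in $H(\mathfrak{C}_n)$. $\mathcal{H}(T)$ is the subgroup of $H(\mathfrak{C}_n)$ generated by all completions of $T$ in $H(\mathfrak{C}_n)$. The group $\mathcal{F}(T)$. A homeomorphism $h$ of $\mathfrak{C}_n$ locally agrees with a group $G\le H(\mathfrak{C}_n)$ if for every $x\in\mathfrak{C}_n$ there are an open neighbourhood $U$ of $x$ and $g\in G$ with $h|_U=g|_U$. For $T\in\mathfrak{P}_n$ having a completion in $H(\mathfrak{C}_n)$, $\mathcal{F}(T)$ is the group of all homeomorphisms of $\mathfrak{C}_n$ which locally agree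 with $\mathcal{H}(T)$. Partial inverse. Let $T\in\mathfrak{P}_n$. For a state $q$ and $\alpha\in X_n^*$, $\mathcal{L}_q(\alpha)$ is the longest common prefix of all words in the preimage of $[\alpha]$ under $T_q$. For each state $q$ let $\{[\eta_{1,q}],\dots,[\eta_{r_q,q}]\}$ be a minimal (smallest) set of cones with union $\mathrm{im}(q)$. Put $\nu_{i,q}=\mathcal{L}_q(\eta_{i,q})$, $w_{i,q}=\eta_{i,q}-\lambda_T(\nu_{i,q},q)$, $p_{i,q}=\pi_T(\nu_{i,q},q)$ and $Q'_0=\{(w_{i,q},p_{i,q}):q\in Q_T,1\le i\le r_q\}$. The state set of the partial inverse $T'$ is the closure of $Q'_0$ under the transitions, for $x\in X_n$, $\pi_{T'}(x,(w,p))=\big(wx-\lambda_T(\mathcal{L}_p(wx),p),\pi_T(\mathcal{L}_p(wx),p)\big)$, with outputs $\lambda_{T'}(x,(w,p))=\mathcal{L}_p(wx)$; this closure is finite and $T'\in\mathfrak{P}_n$. Contracting. $\Pi(T)$ is the set of all finite products of $T$ and $T'$ (i.e. products whose factors each equal $T$ or $T'$). $T\in\mathfrak{P}_n$ is contracting if for every $U\in\Pi(T)$ and every state $q$ of $U$, $U_q$ is $\omega$-equivalent to an initial transducer $W_p$ for which there is $j\in\mathbb{N}$ such that after reading any word of length $j$, $W_p$ acts as a state of $T$ (that is, the state of $W$ reached induces the same map on $\mathfrak{C}_n$ as some state of $T$). *)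

(* Defs.v *)
From HB Require Import structures.
From mathcomp Require Import all_boot all_order all_algebra.
From mathcomp Require Import all_classical.
From mathcomp Require Import topology function_spaces.

Set Implicit Arguments.
Unset Strict Implicit.
Unset Printing Implicit Defensive.

Local Open Scope classical_set_scope.

Definition word (n : nat) := seq 'I_n.

Definition cantor (n : nat) : Type := {ptws nat -> discrete_topology 'I_n}.

HB.instance Definition _ n := Nbhs.on (cantor n).
HB.instance Definition _ n := Topological.on (cantor n).

Section Words.
Variable n : nat.

Definition catw (w : word n) (chi : cantor n) : cantor n :=
  fun i => if (i < size w)%N then nth (chi i) w i else chi (i - size w)%N.

Definition cone (w : word n) : set (cantor n) := range (catw w).

Definition is_lcp (A : set (cantor n)) (w : word n) : Prop :=
  A `<=` cone w /\ forall v, A `<=` cone v -> (size v <= size w)%N.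

(* The default [::] is only reached when A is empty or a singleton, or n < 2.
   For n >= 2, preimages of cones that meet the image of an injective
   continuous map have at least two points. *)
Definition lcp (A : set (cantor n)) : word n := xget [::] (is_lcp A).

(* A smallest set of cones with union A, given by its defining words. *)
Definition minimal_cones (A : set (cantor n)) (s : seq (word n)) : Prop :=
  \bigcup_(eta in [set` s]) cone eta = A /\
  forall s' : seq (word n),
    \bigcup_(eta in [set` s']) cone eta = A -> (size s <= size s')%N.

Definition homeomorphism (h : cantor n -> cantor n) : Prop :=
  continuous h /\
  exists g : cantor n -> cantor n, [/\ continuous g, cancel h g & cancel g h].

Definition is_subgroup (G : set (cantor n -> cantor n)) : Prop :=
  [/\ G `<=` homeomorphism,
      G id,
      forall g h, G g -> G h -> G (h \o g) &
      forall g g', G g -> cancel g g' -> cancel g' g -> G g'].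

Definition locally_agrees (G : set (cantor n -> cantor n))
    (h : cantor n -> cantor n) : Prop :=
  forall x : cantor n, exists (U : set (cantor n)) (g : cantor n -> cantor n),
    [/\ open U, U x, G g & forall y, U y -> h y = g y].

End Words.

(* Raw machines: finiteness of the state set and infinite output on infinite
   input are imposed separately, by [is_transducer]. *)
Record machine (n : nat) := Machine {
  state : Type;
  trans : 'I_n -> state -> state;
  out : 'I_n -> state -> word n }.

Section Transducers.
Variable n : nat.
Implicit Types T R : machine n.

Fixpoint transw T (w : word n) (q : state T) : state T :=
  if w is x :: w' then transw w' (trans x q) else q.

Fixpoint outw T (w : word n) (q : state T) : word n :=
  if w is x :: w' then out x q ++ outw w' (trans x q) else [::].

Definition is_transducer T : Prop :=
  finite_set [set: state T] /\
  forall (q : state T) (delta : cantor n) (m : nat),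
    exists k, (m <= size (outw (mkseq delta k) q))%N.

(* Letter i of the output is read off any prefix of delta whose output is long
   enough; the defaults are irrelevant when [is_transducer T]. *)
Definition out_map T (q : state T) (delta : cantor n) : cantor n :=
  fun i =>
    let k := xget 0%N [set k | (i < size (outw (mkseq delta k) q))%N] in
    nth (delta i) (outw (mkseq delta k) q) i.

Definition im T (q : state T) : set (cantor n) := range (out_map q).

Definition omega_equiv T R (t : state T) (r : state R) : Prop :=
  forall delta, out_map t delta = out_map r delta.

Definition partially_invertible T : Prop :=
  is_transducer T /\
  forall q : state T, injective (out_map q) /\ clopen (im q).

Definition product T R : machine n :=
  @Machine n (state T * state R)%type
    (fun i s => (trans i s.1, transw (out i s.1) s.2))
    (fun i s => outw (out i s.1) s.2).

Definition viable T l (rho : 'I_l -> word n) (p : 'I_l -> state T) : Prop :=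
  \bigcup_i (catw (rho i) @` im (p i)) = setT /\
  trivIset setT (fun i => catw (rho i) @` im (p i)).

Definition maximal_antichain l (eta : 'I_l -> word n) : Prop :=
  \bigcup_i cone (eta i) = setT /\ trivIset setT (fun i => cone (eta i)).

Definition completion T (h : cantor n -> cantor n) : Prop :=
  exists l (rho : 'I_l -> word n) (p : 'I_l -> state T) (eta : 'I_l -> word n),
    [/\ viable rho p, l = 1 %[mod n.-1], maximal_antichain eta,
        homeomorphism h &
        forall i chi, h (catw (eta i) chi) = catw (rho i) (out_map (p i) chi)].

Definition H_group T : set (cantor n -> cantor n) :=
  smallest (@is_subgroup n) (completion T).

Definition F_group T : set (cantor n -> cantor n) :=
  [set h | homeomorphism h /\ locally_agrees (H_group T) h].

Definition preim_lcp T (q : state T) (alpha : word n) : word n :=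
  lcp (out_map q @^-1` cone alpha).

(* For nu = preim_lcp q alpha: the pair (alpha - outw nu q, transw nu q). *)
Definition residual T (q : state T) (alpha : word n) : word n * state T :=
  let nu := preim_lcp q alpha in
  (drop (size (outw nu q)) alpha, transw nu q).

Inductive pinv_state T : word n * state T -> Prop :=
| pinv_init (q : state T) s eta :
    minimal_cones (im q) s -> eta \in s -> pinv_state (residual q eta)
| pinv_step x w p :
    pinv_state (w, p) -> pinv_state (residual p (rcons w x)).

Definition pinv_trans T (x : 'I_n) (s : {s | @pinv_state T s}) :
    {s | @pinv_state T s} :=
  let: exist (w, p) ws := s in exist _ _ (pinv_step x ws).

Definition partial_inverse T : machine n :=
  @Machine n {s | @pinv_state T s} (@pinv_trans T)
    (fun x s => preim_lcp (sval s).2 (rcons (sval s).1 x)).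

Inductive inverse_products T : machine n -> Prop :=
| ip_self : inverse_products T T
| ip_inv : inverse_products T (partial_inverse T)
| ip_prod U V : inverse_products T U -> inverse_products T V ->
    inverse_products T (product U V).

Definition contracting T : Prop :=
  forall U, inverse_products T U -> forall q : state U,
  exists (W : machine n) (p : state W),
    [/\ is_transducer W, omega_equiv q p &
        exists j : nat, forall w : word n, size w = j ->
          exists t : state T, omega_equiv (transw w p) t].

End Transducers.

(* Main.v *)
Require Import Defs.
From mathcomp Require Import all_boot.
From mathcomp Require Import boolp classical_sets.
From mathcomp Require Import topology function_spaces.

Set Implicit Arguments.
Unset Strict Implicit.
Unset Printing Implicit Defensive.

Local Open Scope classical_set_scope.

(** Both groups turn out to be equal to the set of all completions of [T], which
    is also the set of all homeomorphisms that act locally like states of [T]: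
    every point has a prefix [u] such that, on the cone of [u], the map replaces
    [u] by a fixed word and applies a state of [T] to the rest
    ([acts_locally]).

    A completion acts locally in this sense by definition. Conversely, Cantor
    space being compact, a homeomorphism [h] that acts locally does so on the
    cones of all words of some common length [k]; these [n ^ k] words form a
    maximal antichain, [n ^ k] is [1] modulo [n - 1], and the bijectivity of [h]
    says that the images of the cones partition Cantor space, so that [h] is a
    completion ([acts_locally_completion]).

    The contracting hypothesis makes the homeomorphisms that act locally a
    group, the identity being a completion followed by its inverse. A composite
    of two of them acts locally like states of the product of [T] with itself ([acts_locally_comp]), and an inverse acts locally like
    states of the partial inverse of [T] ([acts_locally_inv]); in both cases
    reading finitely many further letters leads back to states of [T]. The
    second point rests on the fact that a state [(w, p)] of the partial inverse
    sends [y] to the preimage of [w y] under the map induced by [p]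
    ([partial_inverseK]). Its output along a nonempty prefix [v] of [y] is the
    longest common prefix of the preimage of the cone of [w v], and these words
    grow without bound because the inverse of the map induced by [p] is
    continuous.

    Hence the group generated by the completions consists of homeomorphisms that
    act locally, and a homeomorphism that agrees locally with this group acts
    locally as well; it is therefore a completion. *)

(** * Cantor space: prefixes, cones, bar induction *)

Section CantorSpace.
Variable n : nat.
Implicit Types (u v w : word n) (x y : cantor n).

Lemma mkseq_addn (A : Type) (f : nat -> A) a b :
  mkseq f (a + b) = mkseq f a ++ mkseq (fun i => f (a + i)) b.
Proof.
rewrite /mkseq iotaD map_cat add0n; congr (_ ++ _).
by rewrite -[in LHS](addn0 a) iotaDl -map_comp.
Qed.

Lemma catwE w x i a :
  catw w x i = if i < size w then nth a w i else x (i - size w).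
Proof. by rewrite /catw; case: ifP => // lt_iw; apply: set_nth_default. Qed.

Lemma catwD w x i : catw w x (size w + i) = x i.
Proof. by rewrite /catw ltnNge leq_addr /= addKn. Qed.

Lemma mkseq_catwD w x k : mkseq (catw w x) (size w + k) = w ++ mkseq x k.
Proof.
rewrite mkseq_addn; congr (_ ++ _); last first.
  by apply: eq_map => i; rewrite catwD.
apply: (@eq_from_nth _ (x 0)); rewrite size_mkseq // => i lt_iw.
by rewrite nth_mkseq // (catwE _ _ _ (x 0)) lt_iw.
Qed.

Lemma mkseq_catw w x : mkseq (catw w x) (size w) = w.
Proof. by rewrite -[X in mkseq _ X]addn0 mkseq_catwD cats0. Qed.

Lemma catw_mkseq x k : catw (mkseq x k) (fun i => x (k + i)) = x.
Proof.
apply: funext => i; rewrite (catwE _ _ _ (x 0)) size_mkseq.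
by case: ltnP => [lt_ik|le_ki]; [rewrite nth_mkseq | rewrite subnKC].
Qed.

Lemma catw0 x : catw [::] x = x.
Proof. by apply: funext => i; rewrite /catw /= subn0. Qed.

Lemma catw_cat u v x : catw (u ++ v) x = catw u (catw v x).
Proof.
apply: funext => i; rewrite !(catwE _ _ _ (x 0)) size_cat nth_cat.
case: ltnP => [lt_i|le_i]; case: (ltnP i (size u)) => // lt_iu.
- by rewrite ltn_subLR // lt_i.
- by have := leq_trans lt_iu (leq_trans (leq_addr _ _) le_i); rewrite ltnn.
- by rewrite ltn_subLR // ltnNge le_i subnDA.
Qed.

Lemma catw_inj w : injective (catw w).
Proof. by move=> x y eq_xy; apply: funext => i; rewrite -(catwD w x) eq_xy catwD. Qed.

Lemma coneP w x : cone w x <-> mkseq x (size w) = w.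
Proof.
split=> [[y _ <-]|<-]; first exact: mkseq_catw.
by rewrite -{2}(catw_mkseq x (size w)); exists (fun i => x (size w + i)).
Qed.

Lemma cone_mkseq x k : cone (mkseq x k) x.
Proof. by apply/coneP; rewrite size_mkseq. Qed.

Lemma cone_nth w x i a : cone w x -> i < size w -> x i = nth a w i.
Proof. by move=> /coneP {2}<- lt_iw; rewrite nth_mkseq. Qed.

Lemma cone_catw w x : cone w (catw w x).
Proof. by exists x. Qed.

Lemma cone_cat u v x : cone v x -> cone (u ++ v) (catw u x).
Proof. by move=> [y _ <-]; rewrite -catw_cat; exists y. Qed.

Lemma cone_catK u v x : cone (u ++ v) (catw u x) -> cone v x.
Proof. by move=> [y _]; rewrite catw_cat => /catw_inj <-; exists y. Qed.

Lemma cone_prefix u v x : cone (u ++ v) x -> cone u x.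
Proof. by move=> [y _ <-]; rewrite catw_cat; exists (catw v y). Qed.

Lemma mkseq_leq x k m : k <= m ->
  mkseq x m = mkseq x k ++ mkseq (fun i => x (k + i)) (m - k).
Proof. by move=> le_km; rewrite -mkseq_addn subnKC. Qed.

(** Of two words whose cones meet, the shorter is a prefix of the longer. *)
Lemma cone_comparable u v x :
  cone u x -> cone v x -> size u <= size v -> v = u ++ drop (size u) v.
Proof.
move=> /coneP ux /coneP vx le_uv; rewrite -{1}(cat_take_drop (size u) v).
by congr (_ ++ _); rewrite -vx (mkseq_leq _ le_uv) take_size_cat ?size_mkseq.
Qed.

(** Bar induction on the tree of finite words (the contrapositive of König's
    lemma): a property that passes from all the children of a word to the word,
    and that holds somewhere along each infinite branch, holds at the root. *)
Lemma bar_induction (P : word n -> Prop) :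
  (forall w, (forall a, P (rcons w a)) -> P w) ->
  (forall x, exists k, P (mkseq x k)) -> P [::].
Proof.
move=> stepP barP; apply: contrapT => nP0.
have nextP w : ~ P w -> exists a, ~ P (rcons w a).
  by move=> nPw; apply/existsNP => all_w; apply: nPw; exact: stepP.
have [a0 _] := nextP _ nP0.
have /choice[next nP_next] w : exists a, ~ P w -> ~ P (rcons w a).
  by have [/nextP[a nPa]|Pw] := pselect (~ P w); [exists a | exists a0].
pose branch k := iter k (fun w => rcons w (next w)) [::].
have nP_branch k : ~ P (branch k) by elim: k => //= k; exact: nP_next.
pose x : cantor n := fun i => next (branch i).
have [k] := barP x; suff -> : mkseq x k = branch k by exact: nP_branch.
by elim: k => // k IHk; rewrite mkseqS IHk.
Qed.

(** Compactness of Cantor space, in the form of a uniform depth. *)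
Lemma uniform_depth (P : word n -> Prop) :
  (forall u v, P u -> P (u ++ v)) ->
  (forall x, exists k, P (mkseq x k)) ->
  exists k, forall w, k <= size w -> P w.
Proof.
move=> extP barP.
apply: (@bar_induction (fun u => exists k, forall v, k <= size v -> P (u ++ v))).
  move=> w /choice[k kP]; exists (\max_a k a).+1 => -[|a v] //=.
  rewrite ltnS => le_v; rewrite -cat_rcons; apply: kP.
  exact: leq_trans (leq_bigmax _) le_v.
by move=> x; have [k Pk] := barP x; exists k, 0 => v _; exact: extP.
Qed.

(** Cones of prefixes form a neighbourhood basis. *)
Lemma open_cone (U : set (cantor n)) x :
  open U -> U x -> exists k, cone (mkseq x k) `<=` U.
Proof.
move=> oU Ux.
pose F := filter_from setT (fun k => cone (mkseq x k)).
have FF : Filter F.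
  apply: filter_from_filter; first by exists 0.
  move=> i j _ _; exists (i + j) => // y yx.
  split; move: yx; first by rewrite mkseq_addn => /cone_prefix.
  by rewrite addnC mkseq_addn => /cone_prefix.
have Fx : F --> x.
  apply/cvg_sup => i A [B [[O oO <-] Bx BA]].
  exists i.+1 => // y yx; apply: BA => /=.
  have ltii : i < size (mkseq x i.+1) by rewrite size_mkseq.
  by rewrite (cone_nth (x 0) yx ltii) nth_mkseq.
have [|k _] := Fx U; last by exists k.
exact: open_nbhs_nbhs.
Qed.

Lemma homeomorphism_comp (g h : cantor n -> cantor n) :
  homeomorphism g -> homeomorphism h -> homeomorphism (h \o g).
Proof.
move=> [cg [g' [cg' gK g'K]]] [ch [h' [ch' hK h'K]]]; split.
  by move=> x; apply: continuous_comp; [exact: cg | exact: ch].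
exists (g' \o h'); split; first 1 last.
- exact: can_comp.
- exact: can_comp.
- by move=> x; apply: continuous_comp; [exact: ch' | exact: cg'].
Qed.

Lemma homeomorphism_inv (g g' : cantor n -> cantor n) :
  homeomorphism g -> cancel g g' -> cancel g' g -> homeomorphism g'.
Proof.
move=> [cg [f [cf gK fK]]] gK' g'K; split; last by exists g.
by rewrite (_ : g' = f) //; apply: funext => x; rewrite -{1}(fK x) gK'.
Qed.

End CantorSpace.

(** * Outputs of transducers on infinite words *)

Section Outputs.
Variable n : nat.
Implicit Types (u v w : word n) (x y : cantor n) (T R : machine n).

Lemma outw_cat T u v (q : state T) :
  outw (u ++ v) q = outw u q ++ outw v (transw u q).
Proof. by elim: u q => //= a u IHu q; rewrite IHu catA. Qed.

Lemma out_mapE T (q : state T) x k i : i < size (outw (mkseq x k) q) ->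
  out_map q x i = nth (x i) (outw (mkseq x k) q) i.
Proof.
move=> lt_i; rewrite /out_map; case: xgetP => [m _ /= lt_im|/(_ k)//].
wlog le_km : k m lt_i lt_im / k <= m => [Hwlog|].
  by have [/Hwlog->//|/ltnW/Hwlog->] := leqP k m.
by rewrite (mkseq_leq _ le_km) outw_cat nth_cat lt_i.
Qed.

(** The output along [x] need not be infinite here: what has been written is
    never revised, and the other letters of [out_map q x] are irrelevant. *)
Lemma out_map_cone T (q : state T) x k :
  cone (outw (mkseq x k) q) (out_map q x).
Proof.
apply/coneP; apply: (@eq_from_nth _ (x 0)); rewrite size_mkseq // => i lt_i.
by rewrite nth_mkseq // (out_mapE lt_i); apply: set_nth_default.
Qed.

Lemma out_map_unique T (q : state T) x y :
  (forall m, exists2 k, m <= size (outw (mkseq x k) q) &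
                        cone (outw (mkseq x k) q) y) ->
  out_map q x = y.
Proof.
move=> xyP; apply: funext => i; have [k lt_i yk] := xyP i.+1.
by rewrite (out_mapE lt_i) (cone_nth (x i) yk lt_i).
Qed.

Lemma out_map_catw T (q : state T) w x : is_transducer T ->
  out_map q (catw w x) = catw (outw w q) (out_map (transw w q) x).
Proof.
move=> [_ prodT]; apply: out_map_unique => m.
have [k le_m] := prodT (transw w q) x m; exists (size w + k).
  by rewrite mkseq_catwD outw_cat size_cat (leq_trans le_m) ?leq_addl.
by rewrite mkseq_catwD outw_cat; apply: cone_cat; exact: out_map_cone.
Qed.

Lemma outw_product T R w (t : state T) (r : state R) :
  outw w ((t, r) : state (product T R)) = outw (outw w t) r.
Proof. by elim: w t r => //= a w IHw t r; rewrite IHw outw_cat. Qed.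

Lemma out_map_product T R (t : state T) (r : state R) x :
  is_transducer T -> is_transducer R ->
  out_map ((t, r) : state (product T R)) x = out_map r (out_map t x).
Proof.
move=> [_ prodT] [_ prodR]; apply: out_map_unique => m.
set y := out_map t x; have [k le_m] := prodR r y m.
have [k' le_k] := prodT t x k; exists k'; rewrite outw_product.
all: have /coneP <- := out_map_cone t x k'; rewrite -/y.
  by rewrite (mkseq_leq _ le_k) outw_cat size_cat (leq_trans le_m) ?leq_addr.
exact: out_map_cone.
Qed.

(** The inverse of an injective output map is continuous on its image, stated
    with prefixes. *)
Lemma out_map_inv_continuous T (q : state T) x m :
  is_transducer T -> injective (out_map q) ->
  exists k, forall y, cone (mkseq (out_map q x) k) (out_map q y) ->
    cone (mkseq x m) y.
Proof.
move=> [_ prodT] injq.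
have [||k kP] := @bar_induction n (fun w => exists k, forall y, cone w y ->
    cone (mkseq (out_map q x) k) (out_map q y) -> cone (mkseq x m) y).
- move=> w /choice[k kP]; exists (\max_a k a) => y wy.
  rewrite (mkseq_leq _ (leq_bigmax (y (size w)))) => /cone_prefix.
  apply: kP; apply/coneP.
  by rewrite size_rcons mkseqS; move/coneP: wy => ->.
- move=> z; have [->|neq_zx] := pselect (z = x); first by exists m, 0 => y.
  have [i neq_i] : exists i, out_map q z i <> out_map q x i.
    apply/existsNP => eq_out; apply: neq_zx; apply: injq; exact: funext.
  have [k lt_ik] := prodT q z i.+1; exists k, i.+1 => y /coneP.
  rewrite size_mkseq => eq_yz outy; case: neq_i.
  have lt_iy : i < size (outw (mkseq y k) q) by rewrite eq_yz.
  rewrite (out_mapE lt_ik) -eq_yz (set_nth_default (y i)) // -(out_mapE lt_iy).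
  by rewrite (cone_nth (z i) outy) ?size_mkseq // nth_mkseq.
by exists k => y; apply: kP; exists y; rewrite // catw0.
Qed.

End Outputs.

(** * Longest common prefixes and minimal sets of cones *)

Section LongestCommonPrefix.
Variable n : nat.
Implicit Types (u v w : word n) (x y : cantor n) (A : set (cantor n)).

Lemma lcpP A x y : A x -> A y -> x <> y -> is_lcp A (lcp A).
Proof.
move=> Ax Ay neq_xy; apply: xgetPex.
have [i neq_i] : exists i, x i <> y i.
  by apply/existsNP => eq_xy; apply: neq_xy; exact: funext.
pose P m := `[< exists2 v, size v = m & A `<=` cone v >].
have P0 : exists m, P m.
  by exists 0; apply/asboolP; exists [::] => // z _; exists z; rewrite ?catw0.
have Pi m : P m -> m <= i.
  move/asboolP => [v <- Av]; rewrite leqNgt; apply/negP => lt_i.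
  apply: neq_i; rewrite (cone_nth (x i) (Av _ Ax) lt_i).
  by rewrite (cone_nth (x i) (Av _ Ay) lt_i).
have [m /asboolP[w <- Aw] wP] := ex_maxnP P0 Pi.
by exists w; split=> // v Av; apply: wP; apply/asboolP; exists v.
Qed.

Lemma is_lcp_unique A u v x : A x -> is_lcp A u -> is_lcp A v -> u = v.
Proof.
move=> Ax [Au uP] [Av vP].
have /coneP <- := Au _ Ax; have /coneP <- := Av _ Ax.
by congr mkseq; apply/eqP; rewrite eqn_leq uP // vP.
Qed.

Lemma is_lcp_catw A u w x : A x -> is_lcp A w -> is_lcp (catw u @` A) (u ++ w).
Proof.
move=> Ax [Aw wP]; split=> [_ [y Ay <-]|v uAv]; first exact/cone_cat/Aw.
rewrite size_cat; have [le_vu|/ltnW le_uv] := leqP (size v) (size u).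
  exact: leq_trans le_vu (leq_addr _ _).
have uAx : (catw u @` A) (catw u x) by exists x.
have def_v := cone_comparable (cone_catw u x) (uAv _ uAx) le_uv.
rewrite def_v size_cat leq_add2l; apply: wP => y Ay.
by apply: (@cone_catK n u); rewrite -def_v; apply: uAv; exists y.
Qed.

Lemma cone_two_points u : 1 < n -> exists x y, [/\ cone u x, cone u y & x <> y].
Proof.
move=> n_gt1; pose c i : cantor n := fun=> i : 'I_n.
exists (catw u (c (Ordinal (ltnW n_gt1)))), (catw u (c (Ordinal n_gt1))).
split; try exact: cone_catw.
by move/catw_inj/(congr1 (fun x : cantor n => val (x 0 : 'I_n))).
Qed.

Lemma subset_cone u v : 1 < n -> cone u `<=` cone v ->
  u = v ++ drop (size v) u.
Proof.
move=> n_gt1 sub_uv; have [x [y [ux uy neq_xy]]] := cone_two_points u n_gt1.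
have [le_vu|lt_uv] := leqP (size v) (size u).
  exact: cone_comparable (sub_uv _ ux) ux le_vu.
pose i0 := Ordinal (ltnW n_gt1); pose i1 := Ordinal n_gt1.
pose c i : cantor n := fun=> i : 'I_n.
(* If [v] were strictly longer than [u], its letter at position [size u] would
   have to equal the letter there of every point of the cone of [u]. *)
have letter i : i = nth i0 v (size u).
  rewrite -(cone_nth i0 (sub_uv _ (cone_catw u (c i)))) //.
  by rewrite -[X in catw _ _ X]addn0 catwD.
by have := congr1 val (etrans (letter i0) (esym (letter i1))).
Qed.

Lemma minimal_cones_exist A : clopen A -> exists s, minimal_cones A s.
Proof.
move=> [oA cA].
have [||k kP] := @uniform_depth n (fun w => cone w `<=` A \/ cone w `<=` ~` A).
- by move=> u v [uA|uA]; [left|right] => x /cone_prefix; exact: uA.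
- move=> x; have [Ax|nAx] := pselect (A x).
    by have [k kA] := open_cone oA Ax; exists k; left.
  by have [k kA] := open_cone (closed_openC cA) nAx; exists k; right.
pose P m := `[< exists2 s : seq (word n), size s = m &
  \bigcup_(eta in [set` s]) cone eta = A >].
have exP : exists m, P m.
  pose s := [seq val t | t in [pred t : k.-tuple 'I_n | `[< cone t `<=` A >]]].
  exists (size s); apply/asboolP; exists s => //.
  apply/seteqP; split=> [x [_ /= /fintype.imageP[t /asboolP tA ->]]|x Ax].
    exact: tA.
  have szx : size (mkseq x k) == k by rewrite size_mkseq.
  exists (mkseq x k); last exact: cone_mkseq.
  apply/fintype.imageP; exists (Tuple szx) => //; apply/asboolP => /=.
  have [|//|/(_ _ (cone_mkseq x k))//] := kP (mkseq x k).
  by rewrite size_mkseq.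
have [m /asboolP[s <- sA] sP] := ex_minnP exP.
by exists s; split=> // s' s'A; apply: sP; apply/asboolP; exists s'.
Qed.

End LongestCommonPrefix.

(** * The partial inverse computes local inverses *)

Section PartialInverse.
Variables (n : nat) (T : machine n).
Hypotheses (n_gt1 : 1 < n) (invT : partially_invertible T).
Implicit Types (q : state T) (u v w : word n) (x y : cantor n).

Let transT : is_transducer T := invT.1.

Lemma preim_lcpP q u : cone u `<=` im q ->
  is_lcp (out_map q @^-1` cone u) (preim_lcp q u).
Proof.
move=> sub_u; have [x [y [ux uy neq_xy]]] := cone_two_points u n_gt1.
have [x' _ def_x] := sub_u _ ux; have [y' _ def_y] := sub_u _ uy.
apply: (@lcpP _ _ x' y'); rewrite /preimage /= ?def_x ?def_y //.
by move=> eq_xy'; apply: neq_xy; rewrite -def_x -def_y eq_xy'.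
Qed.

(** When the image of [q] contains the cone of [u], the pair [residual q u] has
    as first component what remains of [u] after removing the output of [q] along
    [preim_lcp q u]. Preimages under [q] of cones inside the cone of [u] are then
    computed from preimages under the state of [residual q u]. *)
Lemma residualP q u : cone u `<=` im q ->
  [/\ u = outw (preim_lcp q u) q ++ (residual q u).1,
      cone (residual q u).1 `<=` im (residual q u).2
    & forall v, preim_lcp q (u ++ v)
        = preim_lcp q u ++ preim_lcp (residual q u).2 ((residual q u).1 ++ v)].
Proof.
move=> sub_u; rewrite /residual /=; set nu := preim_lcp q u.
set w := drop _ _; set p := transw nu q.
have [nuP _] := preim_lcpP sub_u; rewrite -/nu in nuP.
have def_u : u = outw nu q ++ w.
  apply: subset_cone => // y uy; have [x _ def_x] := sub_u _ uy.
  have [|z _ def_z] := nuP x; first by rewrite /preimage /= def_x.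
  by rewrite -def_x -def_z out_map_catw //; exact: cone_catw.
have sub_w : cone w `<=` im p.
  move=> y wy; have := cone_cat (outw nu q) wy; rewrite -def_u => uy.
  have [x _ def_x] := sub_u _ uy.
  have [|z _ def_z] := nuP x; first by rewrite /preimage /= def_x.
  exists z => //; apply: (@catw_inj _ (outw nu q)).
  by rewrite -out_map_catw // def_z.
split=> // v.
have sub_uv : cone (u ++ v) `<=` im q by move=> y /cone_prefix/sub_u.
have sub_wv : cone (w ++ v) `<=` im p by move=> y /cone_prefix/sub_w.
have preim_uv : out_map q @^-1` cone (u ++ v)
    = catw nu @` (out_map p @^-1` cone (w ++ v)).
  apply/seteqP; split=> [x /= uvx|_ [x wvx <-]] /=; last first.
    by rewrite out_map_catw // {1}def_u -catA; exact: cone_cat.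
  have [|z _ def_z] := nuP x; first exact: cone_prefix uvx.
  exists z => //; move: uvx; rewrite -def_z out_map_catw // {1}def_u -catA.
  exact: cone_catK.
have [x [_ [wvx _ _]]] := cone_two_points (w ++ v) n_gt1.
have [x' _ def_x] := sub_wv _ wvx.
have wvx' : (out_map p @^-1` cone (w ++ v)) x' by rewrite /preimage /= def_x.
apply: (is_lcp_unique _ (preim_lcpP sub_uv)); first by rewrite preim_uv; exists x'.
rewrite preim_uv; exact: is_lcp_catw wvx' (preim_lcpP sub_wv).
Qed.

Lemma pinv_state_cone (r : word n * state T) :
  pinv_state r -> cone r.1 `<=` im r.2.
Proof.
elim=> [q s eta [sE _] s_eta|a w p _ sub_w].
  suff /residualP[] : cone eta `<=` im q by [].
  by rewrite -sE => x eta_x; exists eta.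
suff /residualP[] : cone (rcons w a) `<=` im p by [].
by rewrite -cats1 => x /cone_prefix; exact: sub_w.
Qed.

Implicit Type s : state (partial_inverse T).

Lemma sval_pinv_trans a s :
  sval (trans a s) = residual (sval s).2 (rcons (sval s).1 a).
Proof. by case: s => -[]. Qed.

Lemma outw_partial_inverse v s : v != [::] ->
  outw v s = preim_lcp (sval s).2 ((sval s).1 ++ v).
Proof.
elim: v s => // a v IHv s _; rewrite -cat_rcons.
change (outw (a :: v) s) with
  (preim_lcp (sval s).2 (rcons (sval s).1 a) ++ outw v (trans a s)).
have [|_ _ resE] := @residualP (sval s).2 (rcons (sval s).1 a).
  by rewrite -cats1 => x /cone_prefix; apply: pinv_state_cone; exact: svalP.
rewrite resE; congr (_ ++ _); have [->|v_neq0] := eqVneq v [::].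
  apply/esym/nilP; rewrite /nilp -(eqn_add2l (size (preim_lcp (sval s).2
    (rcons (sval s).1 a)))) -size_cat -resE cats0 addn0.
  exact: eqxx.
by rewrite IHv // sval_pinv_trans.
Qed.

(** A state of the partial inverse with components [w] and [p] induces the map
    sending [y] to the preimage of [catw w y] under the map induced by [p]. *)
Lemma partial_inverseK s y :
  out_map (sval s).2 (out_map s y) = catw (sval s).1 y.
Proof.
set w := (sval s).1; set p := (sval s).2.
have sub_w : cone w `<=` im p by exact/pinv_state_cone/svalP.
have [x _ def_x] := sub_w _ (cone_catw w y).
rewrite -def_x; congr out_map; apply: out_map_unique => m.
have [k kP] := out_map_inv_continuous x m transT (invT.2 p).1.
have sub_wk : cone (w ++ mkseq y k.+1) `<=` im p by move=> z /cone_prefix/sub_w.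
have [wkP wk_max] := preim_lcpP sub_wk.
exists k.+1; rewrite outw_partial_inverse // -/w -/p.
  apply: leq_trans (wk_max (mkseq x m) _); first by rewrite size_mkseq.
  move=> z; rewrite /preimage /= => wkz; apply: kP; rewrite def_x.
  move: wkz; rewrite -mkseq_catwD (@mkseq_leq _ _ k) ?cats1; last first.
    exact: leq_trans (leqnSn _) (leq_addl _ _).
  exact: cone_prefix.
by apply: wkP; rewrite /preimage /= def_x; exact/cone_cat/cone_mkseq.
Qed.

End PartialInverse.

(** * Homeomorphisms acting locally like states of a transducer *)

Section LocalAction.
Variables (n : nat) (T : machine n).
Implicit Types (f g h : cantor n -> cantor n) (u v w : word n) (x y : cantor n).

(** [acts_on_cone f u]: on the cone of [u], the map [f] replaces the prefix [u]
    by a fixed word and applies the map induced by a state of [T] to the rest. *)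
Definition acts_on_cone f u : Prop :=
  exists rho (t : state T),
    forall x, f (catw u x) = catw rho (out_map t x).

(** Every point has a prefix on whose cone [f] acts as a state of [T]. The map
    [f] need not be a homeomorphism: this also applies to the maps induced by
    states of other machines. *)
Definition acts_locally f : Prop :=
  forall x, exists k, acts_on_cone f (mkseq x k).

Lemma acts_on_cone_cat f u v :
  is_transducer T -> acts_on_cone f u -> acts_on_cone f (u ++ v).
Proof.
move=> transT [rho [t ft]]; exists (rho ++ outw v t), (transw v t) => x.
by rewrite !catw_cat ft out_map_catw.
Qed.

Lemma contracting_acts_locally U (q : state U) :
  contracting T -> inverse_products T U -> acts_locally (out_map q).
Proof.
move=> contrT prodU x.
have [W [p [transW eq_qp [j jP]]]] := contrT U prodU q.
have [|t eq_t] := jP (mkseq x j); first by rewrite size_mkseq.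
exists j, (outw (mkseq x j) p), t => y.
by rewrite eq_qp out_map_catw // eq_t.
Qed.

Lemma acts_locally_comp f g : is_transducer T -> contracting T ->
  acts_locally f -> acts_locally g -> acts_locally (g \o f).
Proof.
move=> transT contrT fP gP x.
have [k [rho [t ft]]] := fP x; pose x' : cantor n := fun i => x (k + i).
have [m gm] := gP (f x).
have [k' le_m] := transT.2 t x' m.
pose x'' : cantor n := fun i => x' (k' + i).
pose u := rho ++ outw (mkseq x' k') t; pose t' := transw (mkseq x' k') t.
have ft' y : f (catw (mkseq x k ++ mkseq x' k') y) = catw u (out_map t' y).
  by rewrite !catw_cat ft out_map_catw.
have ux : cone u (f x).
  by rewrite -(catw_mkseq x (k + k')) mkseq_addn ft'; exact: cone_catw.
have [sigma [s gs]] : acts_on_cone g u.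
  rewrite (cone_comparable (cone_mkseq (f x) m) ux); first exact: acts_on_cone_cat.
  by rewrite size_mkseq size_cat (leq_trans le_m) ?leq_addl.
have [|j [tau [r ts_r]]] := @contracting_acts_locally (product T T) (t', s)
  contrT _ x''; first by apply: ip_prod; exact: ip_self.
exists (k + (k' + j)), (sigma ++ tau), r => y.
have -> : mkseq x (k + (k' + j)) = (mkseq x k ++ mkseq x' k') ++ mkseq x'' j.
  by rewrite !mkseq_addn catA.
rewrite [in LHS]catw_cat /= ft' gs.
by rewrite -out_map_product // ts_r catw_cat.
Qed.

Lemma acts_locally_inv f g : 1 < n -> partially_invertible T -> contracting T ->
  cancel f g -> cancel g f -> acts_locally f -> acts_locally g.
Proof.
move=> n_gt1 invT contrT fK gK fP y; have transT := invT.1.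
have [k [rho [t ft]]] := fP (g y).
set u := mkseq (g y) k in ft.
pose x' : cantor n := fun i => g y (k + i).
have def_y : y = catw rho (out_map t x').
  by rewrite -ft /u (_ : catw _ _ = g y) ?gK //; exact: catw_mkseq.
have [s sP] := minimal_cones_exist (invT.2 t).2.
have [eta /= s_eta [z _ def_z]] :
    (\bigcup_(eta in [set` s]) cone eta) (out_map t x').
  by rewrite sP.1; exists x'.
have sub_eta : cone eta `<=` im t by move=> x eta_x; rewrite -sP.1; exists eta.
pose st : state (partial_inverse T) := exist _ _ (pinv_init sP s_eta).
have [def_eta _ _] := residualP n_gt1 invT sub_eta.
have [j [tau [r tr]]] := contracting_acts_locally st contrT (ip_inv T) z.
pose nu := preim_lcp t eta.
have gE x : g (catw (rho ++ eta) x) = catw (u ++ nu) (out_map st x).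
  rewrite -[RHS]fK (catw_cat u nu) ft out_map_catw //.
  rewrite (partial_inverseK n_gt1 invT st x) /= -!catw_cat.
  by rewrite -catA -def_eta.
exists (size (rho ++ eta) + j), (u ++ nu ++ tau), r => x.
rewrite [in mkseq _ _]def_y -def_z -catw_cat mkseq_catwD catw_cat gE tr.
by rewrite -catw_cat catA.
Qed.

Lemma completion_homeomorphism h : completion T h -> homeomorphism h.
Proof. by move=> [l [rho [p [eta []]]]]. Qed.

Lemma completion_acts_locally h : completion T h -> acts_locally h.
Proof.
move=> [l [rho [p [eta [_ _ [eta_cover _] _ hE]]]]] x.
have [i _ /coneP eta_x] : (\bigcup_i cone (eta i)) x by rewrite eta_cover.
by exists (size (eta i)), (rho i), (p i); rewrite eta_x.
Qed.

(** By compactness, a homeomorphism that acts locally like the states of [T]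
    does so on the cones of all the words of some fixed length [k]. These form a
    maximal antichain, of [n ^ k] words, which makes it a completion. *)
Lemma acts_locally_completion h : 1 < n -> is_transducer T ->
  homeomorphism h -> acts_locally h -> completion T h.
Proof.
move=> n_gt1 transT homeo_h hP.
have [_ [g [_ hK gK]]] := homeo_h.
have [k kP] := uniform_depth (fun u v => @acts_on_cone_cat h u v transT) hP.
pose eta (i : 'I_#|{: k.-tuple 'I_n}|) : word n := enum_val i.
have eta_cover x : exists i, cone (eta i) x.
  have szx : size (mkseq x k) == k by rewrite size_mkseq.
  exists (enum_rank (Tuple szx)); rewrite /eta enum_rankK; exact: cone_mkseq.
have eta_inj i j x : cone (eta i) x -> cone (eta j) x -> i = j.
  move=> /coneP ix /coneP jx; apply: enum_val_inj; apply: val_inj.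
  by rewrite -[LHS]ix -[RHS]jx !size_tuple.
have /choice[rho /choice[p hE]] i : exists rho (t : state T),
    forall x, h (catw (eta i) x) = catw rho (out_map t x).
  by apply: kP; rewrite size_tuple.
have himE i y : (catw (rho i) @` im (p i)) y -> cone (eta i) (g y).
  by move=> [_ [x _ <-] <-]; rewrite -hE hK; exact: cone_catw.
exists _, rho, p, eta; split=> //.
- split.
    apply/seteqP; split=> // y _; have [i [x _ def_x]] := eta_cover (g y).
    exists i => //; exists (out_map (p i) x); first by exists x.
    by rewrite -hE def_x gK.
  by move=> i j _ _ [y [/himE iy /himE]]; exact: eta_inj.
- rewrite card_tuple card_ord -modnXm.
  by rewrite -{1}(prednK (ltnW n_gt1)) -addn1 modnDl modnXm exp1n.
- split; last by move=> i j _ _ [x []]; exact: eta_inj.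
  by apply/seteqP; split=> // x _; have [i] := eta_cover x; exists i.
Qed.

End LocalAction.

Theorem theorem6p16 (n : nat) (hn : 2 <= n) (T : machine n)
    (hT : partially_invertible T) (hcontr : contracting T)
    (hcompl : exists h : cantor n -> cantor n, completion T h) :
  H_group T = F_group T.
Proof.
have transT := hT.1.
have compl_loc f : completion T f -> homeomorphism f /\ acts_locally T f.
  by move=> fT; split; [apply: completion_homeomorphism fT |
                        apply: completion_acts_locally].
have locH : H_group T `<=` [set f | homeomorphism f /\ acts_locally T f].
  apply: smallest_sub => //=.
  have invP f g : homeomorphism f /\ acts_locally T f ->
      cancel f g -> cancel g f -> homeomorphism g /\ acts_locally T g.
    move=> [homeo_f fP] fK gK.
    by split; [exact: homeomorphism_inv fK gK | exact: acts_locally_inv fK gK fP].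
  have compP f g : homeomorphism f /\ acts_locally T f ->
      homeomorphism g /\ acts_locally T g ->
      homeomorphism (g \o f) /\ acts_locally T (g \o f).
    move=> [homeo_f fP] [homeo_g gP].
    by split; [exact: homeomorphism_comp | exact: acts_locally_comp].
  split=> //; first by move=> f [].
  (* The identity is obtained as a completion followed by its inverse. *)
  have [f fT] := hcompl.
  have [homeo_f fP] := compl_loc f fT.
  have [_ [g [_ fK gK]]] := homeo_f.
  rewrite (_ : id = g \o f); last by apply: funext => x; rewrite /= fK.
  by apply: compP => //; apply: (invP f).
apply/seteqP; split=> [h hH|h [homeo_h agree_h]].
  split; first by have [] := locH h hH.
  by move=> x; exists setT, h; split=> //; exact: openT.
have hP : acts_locally T h.
  move=> x; have [U [g [oU Ux /locH[_ gP] eq_hg]]] := agree_h x.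
  have [k kU] := open_cone oU Ux; have [m gm] := gP x.
  have [rho [t gt]] : acts_on_cone T g (mkseq x (k + m)).
    by rewrite addnC mkseq_addn; exact: acts_on_cone_cat.
  exists (k + m), rho, t => y; rewrite -gt; apply/eq_hg/kU.
  by rewrite mkseq_addn catw_cat; exact: cone_catw.
by move=> G [_ sub_G]; apply: sub_G; exact: acts_locally_completion.
Qed.
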